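(* Let $p$ be an odd prime, $m,s$ positive integers, $R=\mathbb F_{p^m}+u\mathbb F_{p^m}$ with $u^2=0$, and let $\sigma$ be a ring automorphism of $R$ with $\sigma^{-1}=\Theta_{\theta,\varepsilon}$, where $\theta\in \mathrm{Aut}(\mathbb F_{p^m})$ and $\varepsilon\in\mathbb F_{p^m}^\ast$. Let $\alpha,\beta$ be nonzero elements of $\mathbb F_{p^m}$ and let $\alpha_0\in\mathbb F_{p^m}$ be the element with $\alpha_0^{p^s}=\alpha^{-1}$. Let $C=\langle(\alpha_0x-1)^i\rangle\subseteq\mathcal R_{\alpha,\beta}$ be an $(\alpha+u\beta)$-constacyclic code of length $p^s$ over $R$, where $0\le i\le 2p^s$. Then its $\sigma$-dual code is the $(\theta(\alpha^{-1})-u\varepsilon\theta(\beta\alpha^{-2}))$-constacyclic code $$C^{\perp_\sigma}=\left\langle\big(\theta(\alpha_0^{-1})x-1\big)^{2p^s-i}\right\rangle\subseteq\mathcal R_{\theta(\alpha^{-1}),\,-\varepsilon\theta(\beta\alpha^{-2})},$$ which contains $p^{mi}$ codewords.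
   Context: $\Theta_{\theta,\varepsilon}:R\to R$ is the ring automorphism $a+ub\mapsto\theta(a)+u\varepsilon\theta(b)$ ($a,b\in\mathbb F_{p^m}$); every ring automorphism of $R$ has this form. For nonzero $a,b\in\mathbb F_{p^m}$, $\mathcal R_{a,b}=R[x]/\langle x^{p^s}-(a+ub)\rangle$. For a unit $\lambda$ of $R$, a $\lambda$-constacyclic code of length $n$ is an $R$-submodule of $R^n$ stable under $(x_0,\dots,x_{n-1})\mapsto(\lambda x_{n-1},x_0,\dots,x_{n-2})$; it is identified with an ideal of $R[x]/\langle x^n-\lambda\rangle$ via $(c_0,\dots,c_{n-1})\mapsto c_0+c_1x+\cdots+c_{n-1}x^{n-1}$. The $\sigma$-dual of $C\subseteq R^n$ is $C^{\perp_\sigma}=\{\mathbf x\in R^n:\sum_{i=0}^{n-1}c_i\sigma(x_i)=0\text{ for all }\mathbf c\in C\}$. *)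

(* Defs.v *)
From HB Require Import structures.
From mathcomp Require Import all_boot all_order all_algebra.
Set Implicit Arguments.
Unset Strict Implicit.
Unset Printing Implicit Defensive.
Set Warnings "-redundant-canonical-projection".
Import GRing.Theory.
Local Open Scope ring_scope.

(* F + u F with u ^ 2 = 0, as F[X] / (X ^ 2); u is the class of X. *)
Definition dual_num (F : finFieldType) := {poly %/ ('X^2 : {poly F})}.

HB.instance Definition _ (F : finFieldType) := Finite.on (dual_num F).
HB.instance Definition _ (F : finFieldType) :=
  GRing.ComUnitAlgebra.on (dual_num F).

Definition dual_u (F : finFieldType) : dual_num F := 'qX.

Definition dual_mk (F : finFieldType) (a b : F) : dual_num F :=
  a%:A + dual_u F * b%:A.

Definition dual_fst (F : finFieldType) (z : dual_num F) : F :=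
  (z : {poly F})`_0.
Definition dual_snd (F : finFieldType) (z : dual_num F) : F :=
  (z : {poly F})`_1.

Definition Theta (F : finFieldType) (theta : F -> F) (eps : F)
    (z : dual_num F) : dual_num F :=
  dual_mk (theta (dual_fst z)) (eps * theta (dual_snd z)).

Lemma dual_u_sqr (F : finFieldType) : dual_u F ^+ 2 = 0.
Proof.
rewrite /dual_u /qpolyX -rmorphXn /=; apply: val_inj => /=.
by rewrite mk_monic_Xn Pdiv.RingMonic.rmodpp // monicXn.
Qed.

Lemma dual_mkE (F : finFieldType) (a b : F) :
  dual_mk a b = a%:P + b *: 'X :> {poly F}.
Proof.
have uX : dual_u F = 'X :> {poly F}.
  by rewrite in_qpoly_small // mk_monic_Xn size_polyXn size_polyX.
rewrite /dual_mk mulr_algr; change (a *: 1 + b *: (dual_u F : {poly F})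
  = a%:P + b *: 'X).
by rewrite uX alg_polyC.
Qed.

Lemma dual_fst_mk (F : finFieldType) (a b : F) : dual_fst (dual_mk a b) = a.
Proof. by rewrite /dual_fst dual_mkE coefD coefC coefZ coefX mulr0 addr0. Qed.

Lemma dual_snd_mk (F : finFieldType) (a b : F) : dual_snd (dual_mk a b) = b.
Proof. by rewrite /dual_snd dual_mkE coefD coefC coefZ coefX mulr1 add0r. Qed.

Lemma dual_numE (F : finFieldType) (z : dual_num F) :
  z = dual_mk (dual_fst z) (dual_snd z).
Proof.
apply: val_inj; apply: etrans (esym (dual_mkE _ _)); apply/polyP => -[|[|k]];
  rewrite coefD coefC coefZ coefX /= ?mulr0 ?mulr1 ?addr0 ?add0r //.
by apply: big_coef_npoly; rewrite mk_monic_Xn size_polyXn.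
Qed.

Lemma ThetaE (F : finFieldType) (theta : F -> F) (eps a b : F) :
  Theta theta eps (dual_mk a b) = dual_mk (theta a) (eps * theta b).
Proof. by rewrite /Theta dual_fst_mk dual_snd_mk. Qed.

Definition cc_quo (R : finComNzRingType) (n : nat) (lam : R) :=
  {poly %/ ('X^n - lam%:P)}.

HB.instance Definition _ (R : finComNzRingType) (n : nat) (lam : R) :=
  Finite.on (cc_quo n lam).
HB.instance Definition _ (R : finComNzRingType) (n : nat) (lam : R) :=
  GRing.ComAlgebra.on (cc_quo n lam).

(* {poly %/ h} silently replaces h by 'X when h is constant or not monic;
   this does not happen here. *)
Lemma mk_monic_cc (R : finComNzRingType) (n : nat) (lam : R) :
  (0 < n)%N -> mk_monic ('X^n - lam%:P) = 'X^n - lam%:P.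
Proof.
by case: n => // n _; rewrite /mk_monic size_XnsubC // monicXnsubC.
Qed.

Definition cc_class (R : finComNzRingType) (n : nat) (lam : R)
    (q : {poly R}) : cc_quo n lam :=
  in_qpoly ('X^n - lam%:P) q.

Definition principal_ideal (Q : finComNzRingType) (g : Q) : {set Q} :=
  [set a * g | a : Q].

(* ord_pred is the cyclic predecessor: it sends 0 to n - 1. *)
Definition cc_shift (R : finComNzRingType) (n : nat) (lam : R)
    (x : 'rV[R]_n) : 'rV[R]_n :=
  \row_(i < n) (if i == 0%N :> nat then lam * x 0 (ord_pred i)
                else x 0 (ord_pred i)).

Definition constacyclic (R : finComNzRingType) (n : nat) (lam : R)
    (C : {set 'rV[R]_n}) : Prop :=
  submod_closed C /\ (forall c, c \in C -> cc_shift lam c \in C).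

(* rVpoly c is c_0 + c_1 x + ... + c_(n-1) x^(n-1). *)
Definition code_ideal (R : finComNzRingType) (n : nat) (lam : R)
    (C : {set 'rV[R]_n}) : {set cc_quo n lam} :=
  [set cc_class n lam (rVpoly c) | c in C].

Lemma cc_class_rVpoly_bij (R : finComNzRingType) (n : nat) (lam : R) :
  (0 < n)%N -> bijective (fun c : 'rV[R]_n => cc_class n lam (rVpoly c)).
Proof.
move=> n_gt0; have hE := mk_monic_cc lam n_gt0.
have sh : size (mk_monic ('X^n - lam%:P)) = n.+1 by rewrite hE size_XnsubC.
exists (fun q : cc_quo n lam => poly_rV (q : {poly R})) => [c | q].
  by rewrite /cc_class in_qpoly_small ?rVpolyK // sh ltnS size_poly.
have sq : (size (q : {poly R}) <= n)%N by rewrite -ltnS; apply: leq_trans (size_mk_monic q) _; rewrite sh.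
by apply: val_inj; rewrite poly_rV_K // [LHS]in_qpoly_small // size_mk_monic.
Qed.

Definition sigma_dual (R : finComNzRingType) (n : nat) (sigma : R -> R)
    (C : {set 'rV[R]_n}) : {set 'rV[R]_n} :=
  [set x : 'rV[R]_n |
     [forall c in C, \sum_(i < n) c 0 i * sigma (x 0 i) == 0]].

(* Main.v *)
(* Write N = p^s, lam = alpha + u beta and Q = R[x]/(x^N - lam).  The element
   g = alpha0 x - 1 satisfies g^N = (beta / alpha) u, hence g^(2N) = 0, and both
   u and x are polynomials in g over F; by cardinality evaluation at g identifies
   F[T]/(T^(2N)) with Q.  So (g^i) has |F|^(2N - i) elements and annihilator
   (g^(2N - i)).

   For words c and d, the sum of the c_i sigma(d_i) is the constant coefficient
   of c(x) d~ in Q, where d~ is the sum of the sigma(d_j) x^(-j).  Since this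
   pairing is nondegenerate, d lies in the dual of the code of (g^i) iff
   g^i d~ = 0.  The map d |-> d~ comes from a sigma-semilinear ring morphism that
   sends theta(alpha0^-1) X - 1 to a multiple of g, so the announced ideal is
   contained in the dual, and counting gives equality. *)
Require Import Defs.
From HB Require Import structures.
From mathcomp Require Import all_boot all_order all_algebra.
From mathcomp Require Import finfield.
Set Implicit Arguments.
Unset Strict Implicit.
Unset Printing Implicit Defensive.
Import GRing.Theory.
Local Open Scope ring_scope.

(** * Rings generated over a finite field by one nilpotent element *)

Section NilpotentGenerator.

Variables (F : finFieldType) (Q : finComNzRingType) (f : {rmorphism F -> Q}).
Variables (g : Q) (n : nat).
Hypothesis gn0 : g ^+ n = 0.
Hypothesis horner_surj : forall z, exists P, z = (map_poly f P).[g].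
Hypothesis cardQ : #|Q| = (#|F| ^ n)%N.

Lemma horner_take_nilpotent P :
  (map_poly f (take_poly n P)).[g] = (map_poly f P).[g].
Proof.
rewrite -[in RHS](poly_take_drop n P) rmorphD rmorphM /= map_polyXn.
by rewrite hornerD hornerM hornerXn gn0 mulr0 addr0.
Qed.

(** Truncation does not change the value at [g], so the [#|F| ^ n] polynomials of degree below [n]
    already map onto [Q]; as [Q] has the same cardinality, the map is injective. *)
Lemma horner_rVpoly_inj :
  injective (fun v : 'rV[F]_n => (map_poly f (rVpoly v)).[g]).
Proof.
set h := fun v => _; suff inj_h : {in [set: 'rV[F]_n] &, injective h}.
  by move=> v w; apply: inj_h; rewrite inE.
apply/imset_injP; have -> : h @: [set: 'rV[F]_n] = [set: Q].
  apply/setP => z; rewrite inE; apply/imsetP.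
  have [P ->] := horner_surj z; exists (poly_rV (take_poly n P)) => //.
  by rewrite /h poly_rV_K ?size_take_poly // horner_take_nilpotent.
by rewrite !cardsT cardQ card_mx mul1n.
Qed.

Lemma horner_nilpotent_eq0 P : (map_poly f P).[g] = 0 -> 'X^n %| P.
Proof.
move=> P0; rewrite -(poly_take_drop n P) dvdp_addl ?dvdp_mull //.
suff /(congr1 (@rVpoly F n)) : poly_rV (take_poly n P) = 0 :> 'rV[F]_n.
  by rewrite linear0 poly_rV_K ?size_take_poly // => ->.
apply: horner_rVpoly_inj; rewrite /= linear0 rmorph0 horner0.
by rewrite poly_rV_K ?size_take_poly // horner_take_nilpotent.
Qed.

(** With [z] the value of [P] at [g], the polynomial [P * 'X^i] vanishes at [g], hence is a multiple
    of ['X^n]; then ['X^i] cancels in [{poly F}]. *)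
Lemma annihilator_nilpotent_power i z : (i <= n)%N ->
  z * g ^+ i = 0 -> z \in principal_ideal (g ^+ (n - i)).
Proof.
move=> le_in; have [P ->] := horner_surj z => zg0.
have /dvdpP[T] : 'X^(n - i) %| P.
  rewrite -(@dvdp_mul2r _ 'X^i) -?exprD ?subnK ?expf_neq0 ?polyX_eq0 //.
  apply: horner_nilpotent_eq0.
  by rewrite rmorphM /= map_polyXn hornerM hornerXn.
move=> ->; apply/imsetP; exists (map_poly f T).[g] => //.
by rewrite rmorphM /= map_polyXn hornerM hornerXn.
Qed.

(** Only the lowest [n - i] coefficients of [P] affect the value of [P * 'X^i] at [g]. They are
    determined by it: the difference of two candidates is a multiple of ['X^(n - i)] of smaller
    degree. *)
Lemma card_principal_ideal_nilpotent i : (i <= n)%N ->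
  #|principal_ideal (g ^+ i)| = (#|F| ^ (n - i))%N.
Proof.
move=> le_in.
pose h (v : 'rV[F]_(n - i)) := (map_poly f (rVpoly v * 'X^i)).[g].
have hE P : (map_poly f (P * 'X^i)).[g] = (map_poly f P).[g] * g ^+ i.
  by rewrite rmorphM /= map_polyXn hornerM hornerXn.
have -> : principal_ideal (g ^+ i) = h @: [set: 'rV[F]_(n - i)].
  apply/setP => z; apply/imsetP/imsetP => [[w _ ->] | [v _ ->]].
    have [P ->] := horner_surj w; exists (poly_rV (take_poly (n - i) P)) => //.
    rewrite /h poly_rV_K ?size_take_poly // -hE.
    rewrite -[in LHS](poly_take_drop (n - i) P) mulrDl -mulrA -exprD subnK //.
    rewrite rmorphD hornerD [in X in _ + X]rmorphM /= map_polyXn hornerM.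
    by rewrite hornerXn gn0 mulr0 addr0.
  by exists (map_poly f (rVpoly v)).[g]; rewrite // /h hE.
rewrite card_imset; first by rewrite cardsT card_mx mul1n.
move=> v w /eqP; rewrite -subr_eq0 -hornerN -hornerD -rmorphB /= -mulrBl.
move=> /eqP/horner_nilpotent_eq0; rewrite -{1}(subnK le_in) exprD.
rewrite dvdp_mul2r ?expf_neq0 ?polyX_eq0 // -raddfB /=.
move=> /dvdp_leq dvdv; apply/eqP; rewrite -subr_eq0 -[_ - _]rVpolyK.
have [->|/dvdv] := eqVneq (rVpoly (v - w)) 0; first by rewrite linear0.
by rewrite size_polyXn ltnNge size_poly.
Qed.

End NilpotentGenerator.

(** * Words as elements of the quotient by ['X^n - lam%:P] *)

HB.instance Definition _ (R : finComNzRingType) (n : nat) (lam : R) :=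
  GRing.Linear.copy (@cc_class R n lam)
    (in_qpoly ('X^n - lam%:P) : {poly R} -> cc_quo n lam).
HB.instance Definition _ (R : finComNzRingType) (n : nat) (lam : R) :=
  GRing.RMorphism.copy (@cc_class R n lam)
    (in_qpoly ('X^n - lam%:P) : {poly R} -> cc_quo n lam).

Section ConstacyclicQuotient.

Variables (R : finComNzRingType) (n : nat) (lam : R).
Hypothesis n_gt0 : (0 < n)%N.

Local Notation cls := (@cc_class R n lam).
Local Notation x := (cls 'X).

Lemma card_cc_quo : #|cc_quo n lam| = (#|R| ^ n)%N.
Proof. by rewrite card_qpoly mk_monic_cc // size_XnsubC. Qed.

Lemma cc_class_small (P : {poly R}) :
  (size P <= n)%N -> cls P = P :> {poly R}.
Proof. by move=> sP; rewrite in_qpoly_small // mk_monic_cc // size_XnsubC. Qed.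

Lemma cc_class_id (z : cc_quo n lam) : cls (z : {poly R}) = z.
Proof. by apply: val_inj; rewrite [LHS]in_qpoly_small // size_mk_monic. Qed.

Lemma cc_class_eq0 (P : {poly R}) :
  cls P = 0 -> exists T, P = T * ('X^n - lam%:P).
Proof.
move=> /(congr1 val) /= P0; exists (Pdiv.Ring.rdivp P ('X^n - lam%:P)).
rewrite [LHS](@Pdiv.RingMonic.rdivp_eq _ ('X^n - lam%:P)) ?monicXnsubC //.
by rewrite -(mk_monic_cc lam n_gt0) P0 addr0.
Qed.

Lemma cc_classZ a (P : {poly R}) : cls (a *: P) = a *: cls P.
Proof. exact: linearZ. Qed.

Lemma cc_classC a : cls a%:P = a%:A.
Proof. by rewrite -alg_polyC cc_classZ rmorph1. Qed.

Lemma cc_class_modulus : cls ('X^n - lam%:P) = 0.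
Proof.
apply/val_inj => /=.
by rewrite mk_monic_cc // Pdiv.RingMonic.rmodpp // monicXnsubC.
Qed.

Lemma cc_class_Xn : x ^+ n = lam%:A.
Proof.
have /eqP := cc_class_modulus.
by rewrite rmorphB rmorphXn /= cc_classC subr_eq0 => /eqP.
Qed.

Lemma cc_class_sum (P : {poly R}) : cls P = \sum_(k < size P) P`_k *: x ^+ k.
Proof.
rewrite -[P in LHS]coefK poly_def rmorph_sum; apply: eq_bigr => k _ /=.
by rewrite cc_classZ rmorphXn.
Qed.

Lemma cc_class_rVpoly (c : 'rV[R]_n) :
  cls (rVpoly c) = \sum_(k < n) c 0 k *: x ^+ k.
Proof.
rewrite /rVpoly poly_def rmorph_sum; apply: eq_bigr => k _ /=.
by rewrite cc_classZ rmorphXn valK.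
Qed.

Lemma cc_class_shift (c : 'rV[R]_n) :
  cls (rVpoly (cc_shift lam c)) = x * cls (rVpoly c).
Proof.
set P := rVpoly c; have sP : (size P <= n)%N by apply: size_poly.
(* Multiplication by ['X] pushes the last entry into degree [n]; this multiple of the modulus brings
   it back to degree 0 with the factor [lam]. *)
have -> : rVpoly (cc_shift lam c) =
    'X * P - P`_n.-1 *: ('X^n - lam%:P).
  apply/polyP => k; rewrite coefB coefXM coefZ coefB coefXn coefC.
  rewrite coef_rVpoly; case: insubP => [j _ <- | ]; last first.
    rewrite -leqNgt leq_eqVlt => /predU1P[<- | lt_nk].
      by rewrite eqxx gtn_eqF // subr0 mulr1 subrr.
    rewrite !gtn_eqF ?(leq_trans _ lt_nk) // subr0 mulr0 subr0.
    by rewrite nth_default // (leq_trans sP) // -ltnS (ltn_predK lt_nk).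
  have cE : c 0 (ord_pred j) = P`_(ord_pred j) by rewrite coef_rVpoly_ord.
  rewrite mxE (ltn_eqF (ltn_ord j)) cE /=; have [-> | j0] := posnP j.
    by rewrite add0n modn_small ?ltn_predL // !sub0r mulrN opprK mulrC.
  rewrite subrr mulr0 subr0 -{1}(prednK j0) addSn /= modnDr modn_small //.
  exact: leq_ltn_trans (leq_pred _) (ltn_ord j).
by rewrite rmorphB rmorphM /= cc_classZ cc_class_modulus scaler0 subr0.
Qed.

Lemma card_code_ideal (C : {set 'rV[R]_n}) : #|code_ideal lam C| = #|C|.
Proof. exact: card_imset (bij_inj (cc_class_rVpoly_bij lam n_gt0)). Qed.

Lemma mem_code_ideal (C : {set 'rV[R]_n}) c :
  (cls (rVpoly c) \in code_ideal lam C) = (c \in C).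
Proof. exact: mem_imset (bij_inj (cc_class_rVpoly_bij lam n_gt0)). Qed.

End ConstacyclicQuotient.

(** * The pairing of words and the dual as an annihilator *)

Section SigmaDual.

Variables (R : finComNzRingType) (n : nat) (lam lam' : R).
Variable sigma : {rmorphism R -> R}.
Hypothesis n_gt0 : (0 < n)%N.
Hypothesis sigma_inj : injective sigma.
Hypothesis lamK : sigma lam' * lam = 1.

Local Notation cls := (@cc_class R n lam).
Local Notation x := (cls 'X).

(** The inverse of [x], because [x ^+ n = lam%:A] and [sigma lam' * lam = 1]. *)
Definition cc_Xinv : cc_quo n lam := sigma lam' *: x ^+ n.-1.
Local Notation xinv := cc_Xinv.

Lemma cc_XinvK k : x ^+ k * xinv ^+ k = 1.
Proof.
rewrite -exprMn /xinv -scalerAr -exprS prednK // cc_class_Xn //.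
by rewrite scalerA lamK scale1r expr1n.
Qed.

Lemma cc_Xinv_exp k : (k <= n)%N -> xinv ^+ k = sigma lam' *: x ^+ (n - k).
Proof.
move=> le_kn; rewrite -[RHS]mulr1 -(cc_XinvK k) mulrA -scalerAl -exprD subnK //.
by rewrite cc_class_Xn // scalerA lamK scale1r mul1r.
Qed.

Lemma coef0_cc_X k : (k < n)%N -> (x ^+ k : {poly R})`_0 = (k == 0%N)%:R.
Proof.
by move=> lt_kn; rewrite -rmorphXn cc_class_small ?size_polyXn // coefXn eq_sym.
Qed.

(** If [i < j], the product is a scalar times [x ^+ (n - (j - i))], whose exponent lies strictly
    between 0 and [n]. *)
Lemma coef0_cc_XXinv (i j : 'I_n) :
  (x ^+ i * xinv ^+ j : {poly R})`_0 = (i == j)%:R.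
Proof.
have [le_ji | lt_ij] := leqP j i.
  rewrite -(subnK le_ji) exprD -mulrA cc_XinvK mulr1 coef0_cc_X; last first.
    exact: leq_ltn_trans (leq_subr _ _) (ltn_ord i).
  by rewrite subn_eq0 -val_eqE /= eqn_leq le_ji andbT.
rewrite -(subnK (ltnW lt_ij)) addnC exprD mulrA cc_XinvK mul1r.
rewrite cc_Xinv_exp; last by rewrite (leq_trans (leq_subr _ _)) // ltnW.
rewrite coefZ coef0_cc_X; last by rewrite ltn_subrL subn_gt0 lt_ij.
rewrite subn_eq0 leqNgt (leq_ltn_trans (leq_subr _ _)) // mulr0.
by rewrite -val_eqE ltn_eqF.
Qed.

(* The ring morphism R[X] -> R[x]/(x^n - lam) acting by sigma on scalars and
   sending X to x^-1; it factors through R[x]/(x^n - lam'). *)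
Definition recip (P : {poly R}) : cc_quo n lam :=
  (map_poly (in_alg (cc_quo n lam) \o sigma) P).[xinv].

Lemma recipM P T : recip (P * T) = recip P * recip T.
Proof. by rewrite /recip rmorphM hornerM. Qed.

Lemma recip0 : recip 0 = 0.
Proof. by rewrite /recip rmorph0 horner0. Qed.

Lemma recipD P T : recip (P + T) = recip P + recip T.
Proof. by rewrite /recip rmorphD hornerD. Qed.

Lemma recipB P T : recip (P - T) = recip P - recip T.
Proof. by rewrite /recip rmorphB hornerD hornerN. Qed.

Lemma recipXn P k : recip (P ^+ k) = recip P ^+ k.
Proof. by rewrite /recip rmorphXn horner_exp. Qed.

Lemma recipZ a P : recip (a *: P) = sigma a *: recip P.
Proof. by rewrite /recip map_polyZ hornerZ /= mulr_algl. Qed.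

Lemma recip1 : recip 1 = 1.
Proof. by rewrite /recip rmorph1 hornerC. Qed.

Lemma recipX : recip 'X = xinv.
Proof. by rewrite /recip map_polyX hornerX. Qed.

Lemma recip_rVpoly (c : 'rV[R]_n) :
  recip (rVpoly c) = \sum_(j < n) sigma (c 0 j) *: xinv ^+ j.
Proof.
rewrite /recip /rVpoly poly_def rmorph_sum horner_sum; apply: eq_bigr => k _ /=.
by rewrite map_polyZ map_polyXn hornerZ hornerXn /= mulr_algl valK.
Qed.

(** The morphism kills ['X^n - lam'%:P], since [xinv ^+ n = sigma lam']. *)
Lemma recip_eq P T :
  cc_class n lam' P = cc_class n lam' T -> recip P = recip T.
Proof.
move=> /eqP; rewrite -subr_eq0 -rmorphB => /eqP/(cc_class_eq0 n_gt0)[U].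
move=> PT; apply/eqP; rewrite -subr_eq0 -recipB PT recipM recipB recipXn recipX.
rewrite -alg_polyC recipZ recip1 cc_Xinv_exp // subnn expr0.
by rewrite subrr mulr0.
Qed.

Lemma coef0_mul_recip (c d : 'rV[R]_n) :
  (cls (rVpoly c) * recip (rVpoly d) : {poly R})`_0 =
  \sum_(i < n) c 0 i * sigma (d 0 i).
Proof.
rewrite cc_class_rVpoly recip_rVpoly mulr_suml poly_of_qpoly_sum coef_sum.
apply: eq_bigr => i _; rewrite mulr_sumr poly_of_qpoly_sum coef_sum.
have coefE (j : 'I_n) :
    (c 0 i *: x ^+ i * (sigma (d 0 j) *: xinv ^+ j) : {poly R})`_0
      = c 0 i * sigma (d 0 j) * (i == j)%:R.
  rewrite -scalerAl -scalerAr scalerA -coef0_cc_XXinv.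
  exact: (coefZ _ (_ : {poly R})).
rewrite (eq_bigr _ (fun j _ => coefE j)) (bigD1 i) // eqxx mulr1.
by rewrite big1 /= ?addr0 // => j; rewrite eq_sym => /negPf->; rewrite mulr0.
Qed.

Lemma recip_nondegenerate (d : 'rV[R]_n) :
  (forall c : 'rV[R]_n,
     (cls (rVpoly c) * recip (rVpoly d) : {poly R})`_0 = 0) -> d = 0.
Proof.
move=> d0; apply/rowP => i; apply: sigma_inj; rewrite [in RHS]mxE rmorph0.
have := d0 (delta_mx 0 i).
rewrite coef0_mul_recip (bigD1 i) //= big1 => [|j neq_ji].
  by rewrite mxE !eqxx mul1r addr0 => ->.
by rewrite mxE (negPf neq_ji) mul0r.
Qed.

Lemma recip_rVpoly_inj : injective (fun c : 'rV[R]_n => recip (rVpoly c)).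
Proof.
move=> c d /eqP; rewrite -subr_eq0 -recipB -raddfB /= => /eqP cd0.
apply/eqP; rewrite -subr_eq0; apply/eqP/recip_nondegenerate => e.
by rewrite cd0 mulr0 coef0.
Qed.

(** There are as many words as elements of the quotient, so the injective map [recip] on words
    reaches [w], and nondegeneracy on words applies. *)
Lemma coef0_nondegenerate (w : cc_quo n lam) :
  (forall c : 'rV[R]_n, (cls (rVpoly c) * w : {poly R})`_0 = 0) -> w = 0.
Proof.
have : w \in codom (fun c : 'rV[R]_n => recip (rVpoly c)).
  apply: inj_card_onto recip_rVpoly_inj _ _.
  by rewrite card_cc_quo // card_mx mul1n.
move=> /codomP[d ->] /recip_nondegenerate->.
by rewrite linear0 recip0.
Qed.

(** Since the code is an ideal, orthogonality says that every multiple of [g * recip (rVpoly d)] has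
    constant coefficient 0. *)
Lemma mem_sigma_dual (C : {set 'rV[R]_n}) (g : cc_quo n lam) d :
  code_ideal lam C = principal_ideal g ->
  (d \in sigma_dual sigma C) = (g * recip (rVpoly d) == 0).
Proof.
move=> CE; rewrite inE; apply/forall_inP/eqP => [orth | gd0 c cC].
  apply: coef0_nondegenerate => c.
  have : cls (rVpoly c) * g \in code_ideal lam C.
    by rewrite CE; apply/imsetP; exists (cls (rVpoly c)).
  move=> /imsetP[e eC cgE]; rewrite mulrA cgE coef0_mul_recip.
  exact/eqP/orth.
have : cls (rVpoly c) \in principal_ideal g by rewrite -CE mem_code_ideal.
by move=> /imsetP[a _ cE]; rewrite -coef0_mul_recip cE -mulrA gd0 mulr0 coef0.
Qed.

(** Under [recip], the [lam']-shift becomes multiplication by [recip 'X], which preserves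
    annihilators. *)
Lemma sigma_dual_constacyclic (C : {set 'rV[R]_n}) (g : cc_quo n lam) :
  code_ideal lam C = principal_ideal g ->
  constacyclic lam' (sigma_dual sigma C).
Proof.
move=> CE; split=> [|d]; first split=> [|a d e].
- by rewrite (mem_sigma_dual _ CE) linear0 recip0 mulr0.
- rewrite !(mem_sigma_dual _ CE) linearP /= => /eqP d0 /eqP e0.
  by rewrite recipD recipZ mulrDr e0 -scalerAr d0 scaler0 addr0.
rewrite !(mem_sigma_dual _ CE) => /eqP d0.
rewrite (@recip_eq _ ('X * rVpoly d)).
  2: by rewrite cc_class_shift // rmorphM.
by rewrite recipM mulrCA d0 mulr0.
Qed.

End SigmaDual.

(** * Dual numbers and the generator [a0 x - 1] *)

Lemma dual_mkM (F : finFieldType) (a b c d : F) :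
  dual_mk a b * dual_mk c d = dual_mk (a * c) (a * d + b * c).
Proof.
have mulE (R : comNzRingType) (u x y z t : R) : u ^+ 2 = 0 ->
    (x + u * y) * (z + u * t) = x * z + u * (x * t + y * z).
  move=> u2; rewrite mulrDl !mulrDr [u * y * (u * t)]mulrACA -expr2 u2 mul0r.
  by rewrite addr0 [x * (u * t)]mulrCA -[u * y * z]mulrA addrA.
have AM y z : y%:A * z%:A = (y * z)%:A :> dual_num F.
  by rewrite -(rmorphM (in_alg (dual_num F))).
have AD y z : y%:A + z%:A = (y + z)%:A :> dual_num F.
  by rewrite -(rmorphD (in_alg (dual_num F))).
by apply: etrans (mulE _ _ _ _ _ _ (dual_u_sqr F)) _; rewrite !AM AD.
Qed.

Lemma dual_mk0 (F : finFieldType) (a : F) : dual_mk a 0 = a%:A.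
Proof. by rewrite /dual_mk scale0r mulr0 addr0. Qed.

Section DualNumberCodes.

Variables (F : finFieldType) (p s : nat) (a b a0 : F).
Hypothesis p_odd : odd p.
Hypothesis charF : p \in [pchar F].
Hypotheses (a_neq0 : a != 0) (b_neq0 : b != 0).
Hypothesis a0E : a0 ^+ (p ^ s) = a^-1.

Local Notation N := (p ^ s)%N.
Local Notation R := (dual_num F).
Local Notation lam := (dual_mk a b).
Local Notation Q := (cc_quo N lam).
Local Notation cls := (@cc_class R N lam).
Local Notation g := (cls (a0%:A *: 'X - 1)).
Local Notation f := (in_alg Q \o in_alg R).

Let p_prime : prime p := pcharf_prime charF.

Let N_gt0 : (0 < N)%N.
Proof. by rewrite expn_gt0 prime_gt0. Qed.

Let a0_neq0 : a0 != 0.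
Proof.
apply: contraTneq (invr_neq0 a_neq0) => a00; rewrite -a0E a00.
by rewrite expr0n gtn_eqF // negbK.
Qed.

Lemma in_algA (c : F) (z : Q) : f c * z = c%:A *: z.
Proof. by rewrite /= mulr_algl. Qed.

Lemma dual_mkVl : a^-1%:A * lam = 1 + (b / a)%:A * dual_u F :> R.
Proof.
rewrite /dual_mk mulrDr -(rmorphM (in_alg R)) mulVf // rmorph1 mulrCA.
by rewrite -(rmorphM (in_alg R)) mulrC [a^-1 * b]mulrC.
Qed.

(** By Frobenius the power is [a0 ^+ N] times [x ^+ N], minus 1, that is [a^-1 * lam - 1]; [N] odd
    gives the sign. *)
Lemma generator_expN : g ^+ N = (f (b / a)) * (dual_u F)%:A.
Proof.
have charQ : p \in [pchar Q] by rewrite (rmorph_pchar f).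
rewrite rmorphB rmorph1 /= cc_classZ exprDn_pchar ?pnatX ?pnatE ?charQ //.
rewrite exprNn expr1n mulr1 -signr_odd oddX p_odd orbT expr1 exprZn.
rewrite cc_class_Xn //.
have -> : a0%:A ^+ N = a^-1%:A :> R.
  by rewrite -(rmorphXn (in_alg R)) /= a0E.
have -> : a^-1%:A *: lam%:A = 1 + ((b / a)%:A * dual_u F)%:A :> Q.
  by rewrite scalerA dual_mkVl scalerDl scale1r.
by rewrite addrAC subrr add0r in_algA scalerA.
Qed.

Lemma generator_exp2N : g ^+ (2 * N) = 0.
Proof.
have u2 : (dual_u F)%:A ^+ 2 = 0 :> Q.
  by rewrite -(rmorphXn (in_alg Q)) dual_u_sqr rmorph0.
by rewrite mulnC exprM generator_expN exprMn u2 mulr0.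
Qed.

Lemma generator_surj (z : Q) : exists P, z = (map_poly f P).[g].
Proof.
(* [U] solves [g ^+ N = (b / a) u] for [u]; [X] below solves [g = a0 x - 1] for [x]. Together they
   express every coefficient and every power of [x] through [g]. *)
pose U : {poly F} := (a / b)%:P * 'X^N.
have UE : (map_poly f U).[g] = (dual_u F)%:A.
  rewrite rmorphM /= map_polyC map_polyXn hornerCM hornerXn generator_expN.
  rewrite mulrA -(rmorphM f) mulf_div [a * b]mulrC divff ?mulf_neq0 //.
  by rewrite rmorph1 mul1r.
pose X : {poly F} := a0^-1%:P * ('X + 1).
have XE : (map_poly f X).[g] = cls 'X.
  rewrite rmorphM rmorphD rmorph1 /= map_polyC map_polyX hornerCM hornerD.
  rewrite hornerX hornerC.
  rewrite rmorphB rmorph1 subrK /= cc_classZ in_algA scalerA.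
  by rewrite -(rmorphM (in_alg R)) mulVf // rmorph1 scale1r.
pose D (r : R) := (dual_fst r)%:P + U * (dual_snd r)%:P.
have DE r : (map_poly f (D r)).[g] = r%:A.
  rewrite [r in RHS]dual_numE rmorphD rmorphM hornerD hornerM UE /=.
  rewrite !map_polyC !hornerC /dual_mk [RHS](rmorphD (in_alg Q)).
  by rewrite (rmorphM (in_alg Q)).
exists (\sum_(k < size (z : {poly R})) D (z : {poly R})`_k * X ^+ k).
rewrite rmorph_sum horner_sum -[LHS]cc_class_id cc_class_sum.
apply: eq_bigr => k _.
by rewrite rmorphM rmorphXn hornerM horner_exp XE DE mulr_algl.
Qed.

Lemma card_generator_quotient : #|Q| = (#|F| ^ (2 * N))%N.
Proof.
rewrite card_cc_quo // expnM; congr (_ ^ _)%N.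
by rewrite card_qpoly mk_monic_Xn size_polyXn.
Qed.

Lemma card_generator_ideal i : (i <= 2 * N)%N ->
  #|principal_ideal (g ^+ i)| = (#|F| ^ (2 * N - i))%N.
Proof.
exact: (card_principal_ideal_nilpotent generator_exp2N generator_surj
          card_generator_quotient).
Qed.

Lemma annihilator_generator i z : (i <= 2 * N)%N ->
  z * g ^+ i = 0 -> z \in principal_ideal (g ^+ (2 * N - i)).
Proof.
exact: (annihilator_nilpotent_power generator_exp2N generator_surj
          card_generator_quotient).
Qed.

End DualNumberCodes.

(** * The dual of a power of the generator *)

Theorem theorem3p1 (p m s : nat) (F : finFieldType)
    (p_prime : prime p) (p_odd : odd p) (m_gt0 : (0 < m)%N) (s_gt0 : (0 < s)%N)
    (cardF : #|F| = (p ^ m)%N)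
    (theta : {rmorphism F -> F}) (theta_bij : bijective theta)
    (eps : F) (eps_neq0 : eps != 0)
    (sigma : {rmorphism dual_num F -> dual_num F})
    (sigmaK : cancel sigma (Theta theta eps))
    (ThetaK : cancel (Theta theta eps) sigma)
    (alpha beta alpha0 : F) (alpha_neq0 : alpha != 0) (beta_neq0 : beta != 0)
    (alpha0E : alpha0 ^+ (p ^ s) = alpha^-1)
    (i : nat) (i_le : (i <= 2 * p ^ s)%N)
    (C : {set 'rV[dual_num F]_(p ^ s)})
    (C_cc : constacyclic (dual_mk alpha beta) C)
    (C_ideal : code_ideal (dual_mk alpha beta) C =
       principal_ideal
         (cc_class (p ^ s) (dual_mk alpha beta)
            (alpha0%:A *: 'X - 1) ^+ i)) :
  let lam' := dual_mk (theta alpha^-1)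
                (- (eps * theta (beta * alpha ^- 2))) in
  [/\ constacyclic lam' (sigma_dual sigma C),
      code_ideal lam' (sigma_dual sigma C) =
        principal_ideal
          (cc_class (p ^ s) lam'
             ((theta alpha0^-1)%:A *: 'X - 1) ^+ (2 * p ^ s - i))
    & #|sigma_dual sigma C| = (p ^ (m * i))%N].
Proof.
move=> lam'; set lam := dual_mk alpha beta in C_ideal C_cc *.
set N := (p ^ s)%N in i_le C C_ideal C_cc alpha0E *.
have charF : p \in [pchar F] := card_finPcharP cardF p_prime.
have N_gt0 : (0 < N)%N by rewrite expn_gt0 prime_gt0.
have sigma_inj : injective sigma := can_inj sigmaK.
(* The argument of [Theta] is the inverse of [lam], so [sigma lam'] is that inverse. *)
have lam'E : lam' = Theta theta eps (dual_mk alpha^-1 (- (beta * alpha ^- 2))).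
  by rewrite ThetaE rmorphN mulrN.
have lamK : sigma lam' * lam = 1.
  rewrite lam'E ThetaK /lam dual_mkM mulVf // mulNr expr2 invfM -!mulrA.
  by rewrite mulVf // mulr1 [beta * _]mulrC subrr dual_mk0 scale1r.
have alpha0_neq0 : alpha0 != 0.
  apply: contraTneq (invr_neq0 alpha_neq0) => a00; rewrite -alpha0E a00.
  by rewrite expr0n gtn_eqF // negbK.
have theta_neq0 c : c != 0 -> theta c != 0 by rewrite fmorph_eq0.
have a'_neq0 : theta alpha^-1 != 0 by rewrite theta_neq0 ?invr_eq0.
have b'_neq0 : - (eps * theta (beta * alpha ^- 2)) != 0.
  rewrite oppr_eq0 mulf_neq0 // theta_neq0 // mulf_neq0 //.
  by rewrite invr_eq0 expf_neq0.
(* Thus [theta alpha0^-1] plays for [lam'] the role of [alpha0] for [lam], and the cardinality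
   result for generators applies to [G']. *)
have a0'E : (theta alpha0^-1) ^+ N = (theta alpha^-1)^-1.
  by rewrite -rmorphXn exprVn alpha0E fmorphV.
set g := cc_class N lam _ in C_ideal.
set G' := (theta alpha0^-1)%:A *: 'X - 1.
have le_Ni : (2 * N - i <= 2 * N)%N := leq_subr _ _.
have dualE d :=
  @mem_sigma_dual _ N lam lam' sigma N_gt0 sigma_inj lamK C _ d C_ideal.
(* As [sigma] undoes [theta] on scalars, [G'] goes to [alpha0^-1 x^-1 - 1 = - alpha0^-1 x^-1 (alpha0
   x - 1)]. *)
have recipG : exists c, recip N lam lam' sigma G' = c * g.
  exists (- alpha0^-1%:A *: cc_Xinv N lam lam' sigma).
  rewrite /g /G' recipB recipZ recipX recip1 rmorphB rmorph1 /= cc_classZ.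
  have -> : sigma (theta alpha0^-1)%:A = alpha0^-1%:A.
    by rewrite -dual_mk0 -(mulr0 eps) -(rmorph0 theta) -ThetaE ThetaK dual_mk0.
  have XK : cc_Xinv N lam lam' sigma * cc_class N lam 'X = 1.
    by rewrite mulrC; exact: cc_XinvK N_gt0 lamK 1.
  rewrite mulrBr mulr1 scaleNr opprK addrC mulNr -scalerAl -scalerAr XK.
  rewrite [in RHS]scalerA -(rmorphM (in_alg (dual_num F))) mulVf //.
  by rewrite rmorph1 scale1r.
pose I' := principal_ideal (cc_class N lam' G' ^+ (2 * N - i)).
have card_dual : #|I'| = (p ^ (m * i))%N.
  by rewrite /I' card_generator_ideal // cardF subKn // expnM.
have sub : I' \subset code_ideal lam' (sigma_dual sigma C).
  apply/subsetP => _ /imsetP[z _ ->].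
  have [rV rVK clsK] := cc_class_rVpoly_bij lam' N_gt0.
  rewrite -[z * _]clsK; set d := rV _; rewrite mem_code_ideal //.
  have [c recipE] := recipG; rewrite dualE.
  (* The word [d] may be replaced by any polynomial in its class; with this product, the factors
     [g ^+ i] and [g ^+ (2 * N - i)] combine to 0. *)
  rewrite (recip_eq N_gt0 lamK (T := (z : {poly _}) * G' ^+ (2 * N - i))).
    2: by rewrite clsK rmorphM rmorphXn /= cc_class_id.
  rewrite recipM recipXn recipE exprMn mulrC -!mulrA -exprD subnK //.
  rewrite /g (generator_exp2N _ p_odd charF) //.
  by rewrite !mulr0.
(* [recip] embeds the dual into the annihilator of [g ^+ i], contained in the ideal of
   [g ^+ (2 * N - i)], which has [#|F| ^ i] elements. *)
have le_card : (#|sigma_dual sigma C| <= p ^ (m * i))%N.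
  rewrite -(card_imset _ (recip_rVpoly_inj N_gt0 sigma_inj lamK)).
  rewrite expnM -cardF -[in leqRHS](subKn i_le).
  rewrite -(@card_generator_ideal F p s alpha beta alpha0) //.
  apply/subset_leq_card/subsetP => _ /imsetP[d dC ->].
  move: dC; rewrite dualE mulrC => /eqP d0.
  exact: (@annihilator_generator F p s alpha beta alpha0).
have idealE : I' = code_ideal lam' (sigma_dual sigma C).
  by apply/eqP; rewrite eqEcard sub card_code_ideal // card_dual le_card.
split; last by rewrite -(card_code_ideal lam' N_gt0) -idealE card_dual.
  exact: sigma_dual_constacyclic C_ideal.
exact: esym idealE.
Qed.
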